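(* Let $S$ be a semantics of logic programs that is invariant under renaming of constants, let $\mathcal{T}=\langle P,\mathcal{A},\mathcal{C}\rangle$ be an abductive theory, $O$ an observation, and $(E,F)$ a constrained explanation (of any one of the types A, B, C, D) of $O$ wrt $\mathcal{T}$. Then every constant symbol occurring in $E$ or $F$ occurs in $\mathcal{T}$ or in $O$.
   Context: Fix a vocabulary $\sigma$ of relation and constant symbols (no function symbols) whose set of constants $\mathcal{D}$ is countably infinite. A semantics $S$ assigns to each logic program $Q$ a set $\mathit{sem}_S(Q)$ of Herbrand interpretations; $Q$ is consistent if $\mathit{sem}_S(Q)\neq\emptyset$; a consistent $Q$ skeptically entails $\varphi$ ($Q\models_S\varphi$) if all $M\in\mathit{sem}_S(Q)$ satisfy $\varphi$ (for a set, each member). Invariance under renaming: applying a bijective renaming of constants to a program renames its models accordingly. An abductive theory $\mathcal{T}=\langle P,\mathcal{A},\mathcal{C}\rangle$: $P$ a finite logic program over $\sigma$, $\mathcal{A}$ a finite set of predicate symbols (abducible predicates), $\mathcal{C}$ a finite set of first-order sentences (integrity constraints), and every rule of $P$ with head predicate in $\mathcal{A}$ is a ground fact. Abducibles: ground atoms with predicate in $\mathcal{A}$. Observation: a set of ground atoms with non-abducible predicates. Agreement of $O$ with program $Q$ and $\mathcal{C}$: (A) $Q$ consistent, $Q\models_S\mathcal{C}$, $Q\models_S O$; (B) $Q\models_S O$ and some $M\in \mathit{sem}_S(Q)$ satisfies $\mathcal{C}$; (C) every $M\in\mathit{sem}_S(Q)$ with $M\models\mathcal{C}$ satisfies $O$;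 (D) some $M\in\mathit{sem}_S(Q)$ satisfies $\mathcal{C}$ and $O$. An explanation (of a given type) is a pair $(E,F)$ of disjoint finite sets of abducibles with $F\subseteq P$ such that $O$ agrees (in that sense) with $(P\cup E)\setminus F$ and $\mathcal{C}$. For a set $E$ of ground atoms, an occurrence of a constant $c$ in $E$ is a pair (atom $p(x)\in E$, position $k$) such that the $k$-th argument of $p(x)$ is $c$. For a nonempty set $C$ of occurrences of $c$ in $E$, the replacement function $f_{E,C}:\mathcal{D}\to 2^{\text{abducibles}}$ maps $x$ to the set obtained from $E$ by replacing with $x$ the constant $c$ at each occurrence in $C$. Replacement functions $f_{E,C_1}$ (for constant $c_1$) and $f_{E,C_2}$ (for $c_2$) are independent if $c_1\neq c_2$ or $C_1\cap C_2=\emptyset$. For an explanation $\Delta=(E,F)$ of $O$ wrt $\mathcal{T}$ and a constant $\xi$ not occurring in $E\cup O\cup P$, the degree of arbitrariness $\delta(\Delta)$ is the maximum number of pairwise independent replacement functions $f_{E,C}$ (possibly for different constants) such that $(f_{E,C}(\xi),F)$ is an explanation of $O$ wrt $\mathcal{T}$ (of the same type). $\Delta$ is constrained if $\delta(\Delta)=0$, and arbitrary otherwise.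
   Formalization: The fresh constant ξ in the degree of arbitrariness is also required not to occur in the integrity constraints C; otherwise the degree depends on ξ and the claim fails, e.g. P={o←p(x)}, A={p}, C={¬p(d)}, O={o}, E={p(c)}, ξ=d. *)

(* Defs.v *)
From Stdlib Require List.
From mathcomp Require Import all_boot.
From mathcomp Require Import boolp classical_sets functions cardinality.

Set Implicit Arguments.
Unset Strict Implicit.
Unset Printing Implicit Defensive.

Local Open Scope classical_set_scope.

Record vocabulary := Vocabulary {
  relsym : Type;
  arity : relsym -> nat;
  constsym : Type;
  constsym_countably_infinite : ([set: constsym] #= [set: nat])%card
}.

Inductive term (V : vocabulary) :=
  | Var of nat
  | Cst of constsym V.
Arguments Var {V}.
Arguments Cst {V}.

Record atom (V : vocabulary) (T : Type) := Atom {
  pred_of : relsym V;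
  args : (arity pred_of).-tuple T
}.
Arguments Atom {V T}.

Definition map_atom (V : vocabulary) (T U : Type) (f : T -> U) (a : atom V T) :
  atom V U := Atom (pred_of a) [tuple of map f (args a)].

Definition gatom (V : vocabulary) := atom V (constsym V).

(* The sign is [false] for a default-negated body atom. *)
Definition literal (V : vocabulary) := (bool * atom V (term V))%type.

(* Heads are disjunctions of atoms: one head atom gives a normal rule. *)
Record rule (V : vocabulary) := Rule {
  head : seq (atom V (term V));
  body : seq (literal V)
}.

Definition program (V : vocabulary) := set (rule V).

Definition fact (V : vocabulary) (a : gatom V) : rule V :=
  Rule [:: map_atom Cst a] [::].
Arguments fact {V} a.

Inductive formula (V : vocabulary) :=
  | FBot
  | FAtom of atom V (term V)
  | FEq of term V & term V
  | FImp of formula V & formula V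
  | FAnd of formula V & formula V
  | FOr of formula V & formula V
  | FAll of nat & formula V
  | FEx of nat & formula V.

Section Syntax.
Variable V : vocabulary.
Implicit Types (c : constsym V) (x : nat).

Definition occurs_in_term c (t : term V) : Prop := t = Cst c.

Definition occurs_in_atom c (a : atom V (term V)) : Prop :=
  exists k, occurs_in_term c (tnth (args a) k).

Definition occurs_in_rule c (r : rule V) : Prop :=
  List.Exists (occurs_in_atom c) (head r) \/
  List.Exists (fun l : literal V => occurs_in_atom c l.2) (body r).

Definition occurs_in_program c (P : program V) : Prop :=
  exists2 r, P r & occurs_in_rule c r.

Definition occurs_in_gatoms c (X : set (gatom V)) : Prop :=
  exists2 a, X a & exists k, tnth (args a) k = c.

Fixpoint occurs_in_formula c (phi : formula V) : Prop :=
  match phi with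
  | FBot => False
  | FAtom a => occurs_in_atom c a
  | FEq t u => occurs_in_term c t \/ occurs_in_term c u
  | FImp phi psi | FAnd phi psi | FOr phi psi =>
      occurs_in_formula c phi \/ occurs_in_formula c psi
  | FAll _ phi | FEx _ phi => occurs_in_formula c phi
  end.

Fixpoint free_in x (phi : formula V) : Prop :=
  match phi with
  | FBot => False
  | FAtom a => exists k, tnth (args a) k = Var x
  | FEq t u => t = Var x \/ u = Var x
  | FImp phi psi | FAnd phi psi | FOr phi psi => free_in x phi \/ free_in x psi
  | FAll y phi | FEx y phi => x <> y /\ free_in x phi
  end.

Definition sentence (phi : formula V) : Prop := forall x, ~ free_in x phi.

End Syntax.

Definition interp (V : vocabulary) := set (gatom V).

Definition semantics (V : vocabulary) := program V -> set (interp V).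

Section Satisfaction.
Variable V : vocabulary.
Implicit Types (M : interp V) (v : nat -> constsym V).

Definition eval v (t : term V) : constsym V :=
  match t with Var x => v x | Cst c => c end.

Definition update v (x : nat) (c : constsym V) : nat -> constsym V :=
  fun y => if y == x then c else v y.

Fixpoint sat M v (phi : formula V) : Prop :=
  match phi with
  | FBot => False
  | FAtom a => M (map_atom (eval v) a)
  | FEq t u => eval v t = eval v u
  | FImp phi psi => sat M v phi -> sat M v psi
  | FAnd phi psi => sat M v phi /\ sat M v psi
  | FOr phi psi => sat M v phi \/ sat M v psi
  | FAll x phi => forall c, sat M (update v x c) phi
  | FEx x phi => exists c, sat M (update v x c) phi
  end.

(* The valuation is irrelevant for sentences. *)
Definition satisfies M (phi : formula V) : Prop := forall v, sat M v phi.

Definition satisfies_all M (C : set (formula V)) : Prop :=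
  forall phi, C phi -> satisfies M phi.

End Satisfaction.

Section Renaming.
Variable V : vocabulary.
Implicit Type f : constsym V -> constsym V.

Definition rename_term f (t : term V) : term V :=
  match t with Var x => Var x | Cst c => Cst (f c) end.

Definition rename_rule f (r : rule V) : rule V :=
  Rule [seq map_atom (rename_term f) a | a <- head r]
       [seq (l.1, map_atom (rename_term f) l.2) | l <- body r].

Definition rename_program f (Q : program V) : program V := rename_rule f @` Q.

Definition rename_interp f (M : interp V) : interp V := map_atom f @` M.

Definition renaming_invariant (S : semantics V) : Prop :=
  forall f, bijective f ->
  forall Q, S (rename_program f Q) = rename_interp f @` S Q.

End Renaming.

Record abductive_theory (V : vocabulary) := AbductiveTheory {
  prog : program V;
  abd : set (relsym V);
  constraints : set (formula V);
  prog_finite : finite_set prog;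
  abd_finite : finite_set abd;
  constraints_finite : finite_set constraints;
  constraints_sentence : forall phi, constraints phi -> sentence phi;
  abd_ground_fact : forall r, prog r ->
    List.Exists (fun a => abd (pred_of a)) (head r) -> exists a, r = fact a
}.

Inductive agreement := TypeA | TypeB | TypeC | TypeD.

Section Abduction.
Variables (V : vocabulary) (S : semantics V).
Implicit Types (Q : program V) (C : set (formula V)) (O : set (gatom V)).
Implicit Types (T : abductive_theory V) (t : agreement) (E F : set (gatom V)).

Definition consistent Q : Prop := S Q !=set0.

Definition entails_constraints Q C : Prop :=
  consistent Q /\ forall M, S Q M -> satisfies_all M C.

Definition entails_atoms Q O : Prop :=
  consistent Q /\ forall M, S Q M -> O `<=` M.

Definition agrees t Q C O : Prop :=
  match t with
  | TypeA => [/\ consistent Q, entails_constraints Q C & entails_atoms Q O]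
  | TypeB => entails_atoms Q O /\ exists2 M, S Q M & satisfies_all M C
  | TypeC => forall M, S Q M -> satisfies_all M C -> O `<=` M
  | TypeD => exists2 M, S Q M & satisfies_all M C /\ O `<=` M
  end.

Definition abducible T (a : gatom V) : Prop := abd T (pred_of a).

Definition observation T O : Prop := forall a, O a -> ~ abducible T a.

Definition explanation t T O E F : Prop :=
  [/\ finite_set E /\ E `<=` abducible T,
      finite_set F /\ F `<=` abducible T,
      E `&` F = set0,
      fact @` F `<=` prog T &
      agrees t ((prog T `|` fact @` E) `\` (fact @` F)) (constraints T) O].

Definition occurrence := {a : gatom V & 'I_(arity (pred_of a))}.

Definition occurrences_of (c : constsym V) E : set occurrence :=
  [set o | E (tag o) /\ tnth (args (tag o)) (tagged o) = c].

Definition replace_atom (X : set occurrence) (x : constsym V) (a : gatom V) :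
  gatom V :=
  Atom (pred_of a)
    [tuple (if `[< X (existT _ a k) >] then x else tnth (args a) k)
       | k < arity (pred_of a)].

(* The replacement function f_{E,X}, for X a nonempty set of occurrences of a
   constant in E. *)
Definition replacement E (X : set occurrence) (x : constsym V) :
  set (gatom V) := replace_atom X x @` E.

(* The pair (c, X) is the index of a replacement function f_{E,X} for c. *)
Definition replacement_index := (constsym V * set occurrence)%type.

Definition valid_index E (i : replacement_index) : Prop :=
  i.2 !=set0 /\ i.2 `<=` occurrences_of i.1 E.

Definition independent (i j : replacement_index) : Prop :=
  i.1 <> j.1 \/ i.2 `&` j.2 = set0.

Definition independent_replacements t T O xi E F (n : nat) : Prop :=
  exists r : 'I_n -> replacement_index,
    [/\ forall k, valid_index E (r k),
        forall k l, k <> l -> independent (r k) (r l) &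
        forall k, explanation t T O (replacement E (r k).2 xi) F].

(* [degree t T O xi E F n] means that the degree of arbitrariness of (E, F),
   computed with the fresh constant xi, is n. *)
Definition degree t T O xi E F (n : nat) : Prop :=
  independent_replacements t T O xi E F n /\
  forall m, independent_replacements t T O xi E F m -> (m <= n)%N.

Definition constrained t T O xi E F : Prop := degree t T O xi E F 0.

Definition occurs_in_theory (c : constsym V) T : Prop :=
  occurs_in_program c (prog T) \/
  exists2 phi, constraints T phi & occurs_in_formula c phi.

(* xi must avoid the integrity constraints as well as E, O and the program:
   otherwise the degree depends on the choice of xi. For the program
   {o <- p(x)}, abducible p, constraint ~p(d), O = {o} and E = {p(c)}, the degree is 0
   for xi = d and 1 for every other constant xi <> c. *)
Definition fresh (xi : constsym V) T O E : Prop :=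
  [/\ ~ occurs_in_gatoms xi E, ~ occurs_in_gatoms xi O &
      ~ occurs_in_theory xi T].

End Abduction.

(* Main.v *)
(* If a constant [c] of [E] occurred neither in the theory nor in the observation,
   then the transposition of [c] and [xi] would fix the program, the constraints,
   the observation and [F], and would send [E] to the set obtained by replacing all
   occurrences of [c] by [xi].  By renaming invariance that set is again an
   explanation, so [(E, F)] would be arbitrary.  Constants of [F] occur in the
   program because the facts of [F] are rules of it. *)
Require Import Defs.
From Stdlib Require List.
From mathcomp Require Import all_boot.
From mathcomp Require Import boolp classical_sets functions cardinality.

Set Implicit Arguments.
Unset Strict Implicit.
Unset Printing Implicit Defensive.

Local Open Scope classical_set_scope.

(** Membership is [List.In], matching [List.Exists] in the occurrence predicates: atoms and literals
    are given no decidable equality. *)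
Lemma map_id_List_In (T : Type) (g : T -> T) (s : seq T) :
  (forall a, List.In a s -> g a = a) -> map g s = s.
Proof.
elim: s => //= a s IHs gK.
by rewrite gK ?IHs //; [move=> b sb; apply: gK; right | left].
Qed.

Section MapAtom.
Variable V : vocabulary.

Lemma eq_map_atom (T U : Type) (f g : T -> U) (a : atom V T) :
  (forall k, f (tnth (args a) k) = g (tnth (args a) k)) ->
  map_atom f a = map_atom g a.
Proof.
move=> fg; rewrite /map_atom; congr (Atom _ _).
by apply: eq_from_tnth => k; rewrite !tnth_map.
Qed.

Lemma map_atom_comp (T U W : Type) (g : U -> W) (f : T -> U) (a : atom V T) :
  map_atom g (map_atom f a) = map_atom (g \o f) a.
Proof.
rewrite /map_atom /=; congr (Atom _ _).
by apply: eq_from_tnth => k; rewrite !tnth_map.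
Qed.

Lemma map_atom_fixed (T : Type) (f : T -> T) (a : atom V T) :
  (forall k, f (tnth (args a) k) = tnth (args a) k) -> map_atom f a = a.
Proof.
case: a => p s /= fs; rewrite /map_atom /=; congr (Atom _ _).
by apply: eq_from_tnth => k; rewrite tnth_map fs.
Qed.

End MapAtom.

Section Rename.
Variables (V : vocabulary) (f : constsym V -> constsym V).

Lemma map_atom_rename_fixed (a : atom V (term V)) :
  (forall c, occurs_in_atom c a -> f c = c) -> map_atom (rename_term f) a = a.
Proof.
move=> fa; apply: map_atom_fixed => k.
case E: (tnth (args a) k) => [//|c] /=.
by rewrite fa //; exists k.
Qed.

Lemma rename_rule_fixed (r : rule V) :
  (forall c, occurs_in_rule c r -> f c = c) -> rename_rule f r = r.
Proof.
case: r => h b fr; rewrite /rename_rule /=; congr (Rule _ _);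
  apply: map_id_List_In.
- move=> a ha; apply: map_atom_rename_fixed => c ca; apply: fr; left => /=.
  by apply/List.Exists_exists; exists a.
- move=> [s a] ba; congr pair; apply: map_atom_rename_fixed => c ca.
  by apply: fr; right; apply/List.Exists_exists; exists (s, a).
Qed.

Lemma rename_fact (a : gatom V) : rename_rule f (fact a) = fact (map_atom f a).
Proof. by rewrite /rename_rule /fact /= !map_atom_comp. Qed.

Lemma occurs_in_fact (c : constsym V) (a : gatom V) k :
  tnth (args a) k = c -> occurs_in_rule c (fact a).
Proof.
move=> ac; left; apply/List.Exists_exists; exists (map_atom Cst a).
by split; [left | exists k; rewrite tnth_map ac].
Qed.

(** Only a transposition is applied in the end. For an involution the image of a set is also its
    preimage under the same map, so no separate inverse is carried along. *)
Hypothesis fK : involutive f.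

Lemma map_atomK : involutive (@map_atom V _ _ f).
Proof. by move=> a; rewrite map_atom_comp map_atom_fixed // => k /=. Qed.

Lemma rename_ruleK : involutive (rename_rule f).
Proof.
have tK : involutive (rename_term f) by case=> //= c; rewrite fK.
have aK : involutive (@map_atom V _ _ (rename_term f)).
  by move=> a; rewrite map_atom_comp map_atom_fixed // => k /=.
case=> h b; rewrite /rename_rule /=; congr (Rule _ _);
  rewrite -map_comp; apply: map_id_List_In.
- by move=> a _ /=; rewrite aK.
- by move=> [s a] _ /=; rewrite aK.
Qed.

Lemma rename_interpE (M : interp V) a :
  rename_interp f M a <-> M (map_atom f a).
Proof.
split=> [[b Mb <-]|Mfa]; first by rewrite map_atomK.
by exists (map_atom f a); rewrite ?map_atomK.
Qed.

Lemma eval_rename v (u : term V) :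
  (forall c, occurs_in_term c u -> f c = c) -> eval (f \o v) u = f (eval v u).
Proof. by case: u => //= c ->. Qed.

Lemma update_rename v x c : update (f \o v) x (f c) = f \o update v x c.
Proof. by apply/funext => y; rewrite /update /=; case: eqP. Qed.

(** [f] is an isomorphism from [M] onto its renaming that respects the constants of [phi]: equality
    uses its injectivity, the quantifiers its surjectivity. *)
Lemma sat_rename (M : interp V) phi :
  (forall c, occurs_in_formula c phi -> f c = c) ->
  forall v, sat (rename_interp f M) (f \o v) phi <-> sat M v phi.
Proof.
elim: phi => //=.
- move=> a fa v; rewrite rename_interpE map_atom_comp.
  rewrite (@eq_map_atom V _ _ _ (eval v)) // => k /=.
  rewrite eval_rename ?fK // => c ac; apply: fa; by exists k.
- move=> u w fuw v; rewrite !eval_rename; last 2 first.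
  + by move=> c ?; apply: fuw; right.
  + by move=> c ?; apply: fuw; left.
  by split=> [/(inv_inj fK)|->].
- move=> phi IHphi psi IHpsi fpp v.
  by rewrite IHphi ?IHpsi // => c ?; apply: fpp; [right | left].
- move=> phi IHphi psi IHpsi fpp v.
  by rewrite IHphi ?IHpsi // => c ?; apply: fpp; [right | left].
- move=> phi IHphi psi IHpsi fpp v.
  by rewrite IHphi ?IHpsi // => c ?; apply: fpp; [right | left].
- move=> x phi IHphi fphi v; split=> sphi c.
    by apply/IHphi => //; rewrite -update_rename; apply: sphi.
  by rewrite -[c]fK update_rename; apply/IHphi.
- move=> x phi IHphi fphi v; split=> -[c sphi]; exists (f c).
    by apply/IHphi => //; rewrite -update_rename fK.
  by rewrite update_rename; apply/IHphi.
Qed.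

Lemma satisfies_all_rename (M : interp V) (C : set (formula V)) :
  (forall phi c, C phi -> occurs_in_formula c phi -> f c = c) ->
  satisfies_all (rename_interp f M) C <-> satisfies_all M C.
Proof.
move=> fC; split=> sC phi Cphi v.
  by apply/(@sat_rename M phi (fun c => fC phi c Cphi)); apply: sC.
(* Every valuation factors through [f], the form that [sat_rename] requires. *)
have -> : v = f \o (f \o v) by apply/funext => x /=; rewrite fK.
by apply/sat_rename => [c|]; [apply: fC | apply: sC].
Qed.

Lemma subset_rename_interp (M : interp V) (O : set (gatom V)) :
  (forall a, O a -> map_atom f a = a) ->
  O `<=` rename_interp f M <-> O `<=` M.
Proof.
move=> fO; split=> OM a Oa; last by apply/rename_interpE; rewrite fO //; apply: OM.
by have /rename_interpE := OM _ Oa; rewrite fO.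
Qed.

(** By invariance the models of the renamed program are exactly the renamed models, and renaming
    changes neither the truth of [C] nor that of [O]. *)
Lemma agrees_rename (S : semantics V) t Q C O :
  renaming_invariant S ->
  (forall phi c, C phi -> occurs_in_formula c phi -> f c = c) ->
  (forall a, O a -> map_atom f a = a) ->
  agrees S t Q C O -> agrees S t (rename_program f Q) C O.
Proof.
move=> hS fC fO.
have SQ := hS f (inv_bij fK) Q.
have SE M : S Q M -> S (rename_program f Q) (rename_interp f M).
  by rewrite SQ; exists M.
have con : consistent S Q -> consistent S (rename_program f Q).
  by case=> M /SE; exists (rename_interp f M).
have all (R : interp V -> Prop) : (forall M, R M -> R (rename_interp f M)) ->
    (forall M, S Q M -> R M) -> forall M, S (rename_program f Q) M -> R M.
  by move=> Rf RQ M; rewrite SQ => -[N /RQ /Rf RN <-].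
have sC M : satisfies_all M C -> satisfies_all (rename_interp f M) C.
  by move/(satisfies_all_rename M fC).
have sO M : O `<=` M -> O `<=` rename_interp f M.
  by move/(subset_rename_interp M fO).
case: t => /=.
- case=> cQ [_ QC] [_ QO]; split; first exact: con.
    by split; [exact: con | exact: (all (fun M => satisfies_all M C))].
  by split; [exact: con | exact: (all (fun M => O `<=` M))].
- case=> -[cQ QO] [M QM MC]; split; last by exists (rename_interp f M); auto.
  by split; [exact: con | exact: (all (fun M => O `<=` M))].
(* The constraints are now a premise, so they are pulled back from the renamed model to [M] before
   [O] is pushed forward. *)
- apply: (all (fun M => satisfies_all M C -> O `<=` M)) => M MCO.
  by move/(satisfies_all_rename M fC)/MCO/sO.
- by case=> M QM [MC MO]; exists (rename_interp f M); auto.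
Qed.

(** [F] stays unrenamed: its facts are rules of the program, so [f] fixes all their constants. Only
    [E] moves. *)
Lemma explanation_rename (S : semantics V) t (T : abductive_theory V) O E F :
  renaming_invariant S ->
  (forall c, occurs_in_theory c T \/ occurs_in_gatoms c O -> f c = c) ->
  explanation S t T O E F -> explanation S t T O (map_atom f @` E) F.
Proof.
move=> hS fTO [[Efin Eabd] Fexp EF FP agr].
have fP r : prog T r -> rename_rule f r = r.
  by move=> Pr; apply: rename_rule_fixed => c rc; apply: fTO; left; left; exists r.
have fF a : F a -> map_atom f a = a.
  move=> Fa; apply: map_atom_fixed => k; apply: fTO; left; left.
  by exists (fact a); [apply: FP; exists a | exact: (@occurs_in_fact _ _ k)].
split=> //.
- by split; [exact: finite_image | move=> _ [a Ea <-]; exact: (Eabd _ Ea)].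
- apply/seteqP; split=> // _ [[a Ea <-] Ffa].
  (* The atom [map_atom f a] lies in [F], hence is fixed; applying the involution once more brings
     it back to [a]. *)
  have aF : map_atom f a = a by rewrite -[RHS]map_atomK (fF _ Ffa).
  have : (E `&` F) a by split=> //; rewrite -aF.
  by rewrite EF.
suff -> : (prog T `|` fact @` (map_atom f @` E)) `\` fact @` F =
    rename_program f ((prog T `|` fact @` E) `\` fact @` F).
  apply: agrees_rename => // [phi c Cphi phic|a Oa].
    by apply: fTO; left; right; exists phi.
  by apply: map_atom_fixed => k; apply: fTO; right; exists a => //; exists k.
(* Renaming commutes with the set difference because the complement of the facts of [F] is stable
   under it. *)
have nF r : ~ (fact @` F) r -> ~ (fact @` F) (rename_rule f r).
  move=> nFr [a Fa ar]; apply: nFr; exists a => //.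
  by rewrite -[r]rename_ruleK -ar rename_fact fF.
apply/seteqP; split=> [r [Hr /nF nFr]|_ [r [Hr /nF nFr] <-]].
- exists (rename_rule f r); last exact: rename_ruleK.
  split=> //; case: Hr => [Pr|[_ [a Ea <-] <-]]; first by left; rewrite fP.
  by right; exists a => //; rewrite rename_fact map_atomK.
- split=> //; case: Hr => [Pr|[a Ea <-]]; first by left; rewrite fP.
  by right; exists (map_atom f a); [exists a | rewrite rename_fact].
Qed.

End Rename.

Section Transposition.
Variables (V : vocabulary) (c d : constsym V).

Definition transpose_const (x : constsym V) : constsym V :=
  if `[< x = c >] then d else if `[< x = d >] then c else x.

Lemma transpose_const_id x : x <> c -> x <> d -> transpose_const x = x.
Proof. by move=> xc xd; rewrite /transpose_const !asboolF. Qed.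

Lemma transpose_constK : involutive transpose_const.
Proof.
move=> x; rewrite /transpose_const.
by case: (asboolP (x = c)) => [->|xc]; [|case: (asboolP (x = d)) => [->|xd]];
  repeat case: asboolP => //; congruence.
Qed.

(** Since [d] is absent from [E], the transposition never sends [d] back to [c] there; it acts on
    [E] as a one-way substitution. *)
Lemma replacement_transpose (E : set (gatom V)) : ~ occurs_in_gatoms d E ->
  replacement E (occurrences_of c E) d = map_atom transpose_const @` E.
Proof.
move=> dE; apply: eq_imagel => a Ea; rewrite /replace_atom /map_atom.
congr (Atom _ _); apply: eq_from_tnth => k; rewrite tnth_mktuple tnth_map.
rewrite /transpose_const; case: (asboolP (occurrences_of _ _ _)) => [[_ /= ac]|nac].
  by rewrite asboolT.
rewrite !asboolF // => ak; last by apply: nac.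
by apply: dE; exists a => //; exists k.
Qed.

End Transposition.

Theorem theorem1 (V : vocabulary) (S : semantics V) (T : abductive_theory V)
    (t : agreement) (O E F : set (gatom V)) (xi : constsym V)
    (hS : renaming_invariant S)
    (hO : observation T O)
    (hE : explanation S t T O E F)
    (hxi : fresh xi T O E)
    (hc : constrained S t T O xi E F) :
  forall c : constsym V,
    occurs_in_gatoms c E \/ occurs_in_gatoms c F ->
    occurs_in_theory c T \/ occurs_in_gatoms c O.
Proof.
move=> c [[a Ea [k ak]]|[a Fa [k ak]]]; last first.
  case: hE => _ _ _ FP _; left; left; exists (fact a); first by apply: FP; exists a.
  exact: occurs_in_fact ak.
case: hxi => xiE xiO xiT; apply: contrapT => ncTO.
have fTO x : occurs_in_theory x T \/ occurs_in_gatoms x O ->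
    transpose_const c xi x = x.
  by move=> xTO; apply: transpose_const_id => xE; rewrite xE in xTO; tauto.
have expl := explanation_rename (@transpose_constK _ c xi) hS fTO hE.
(* Degree 0 bounds every independent family by size 0, so a single replacement function is already
   absurd. *)
suff /hc.2 : independent_replacements S t T O xi E F 1 by [].
(* All occurrences of [c] are replaced at once; independence is vacuous for a one-element family. *)
exists (fun=> (c, occurrences_of c E)); split=> [_|i j|_] /=.
- by split=> //; exists (existT _ a k).
- by rewrite !ord1.
- by rewrite replacement_transpose.
Qed.
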